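(* Let $\mathcal{B}=(T,E_{\mathcal{B}})$ be a demand network with root $o$, let $H=(V_H,E_H)$ be a physical network with injective terminal map $\iota:T\to V_H$, let $F\subseteq E_{\mathcal{B}}$, and let $\mathcal{B}^{\sharp}=(T,F)$ be repaired in $H$ by paths $\{\gamma_e:e\in F\}$. Let $\Phi$ be a gauge. Suppose physical edges carry deterministic weights $w_a>0$, $a\in E_H$. For each physical edge $a$ let $m_a=\#\{e\in F:a\in\gamma_e\}$, assumed finite with $\alpha_\Phi(m_a)<\infty$ whenever $m_a\ge1$, and for $e\in F$ define $$W_e(\Phi,w)=\sum_{a\in\gamma_e}w_a\,\beta_\Phi(m_a).$$ If $\mathcal{B}^{\sharp}$ supports a unit flow $\theta$ from $o$ to infinity satisfying $$\sum_{e\in F}W_e(\Phi,w)\,\Phi(|\theta(e)|)<\infty,$$ then the lifted physical flow $\Theta$ satisfies $$\sum_{a\in E_H}w_a\,\Phi(|\Theta(a)|)\le\sum_{e\in F}W_e(\Phi,w)\,\Phi(|\theta(e)|).$$ For the unweighted case $w_a\equiv1$, this reduces to the estimate with $W_e=\sum_{a\in\gamma_e}\beta_\Phi(m_a)$. For quadratic weighted electrical networks, taking $\Phi(t)=t^2$ and $w_a=r_a$ gives $$\sum_{a\in E_H}r_a\,\Theta(a)^2\le\sum_{e\in F}\Bigl(\sum_{a\in\gamma_e}r_a m_a\Bigr)\theta(e)^2.$$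
   Context: Graphs are locally finite and undirected; flows are antisymmetric functions on oriented edges. Since flows to infinity are considered, the graphs are infinite. A demand network is a connected locally finite multigraph $\mathcal{B}=(T,E_{\mathcal{B}})$ (parallel edges allowed) with a distinguished root $o\in T$. A physical network is a locally finite graph $H=(V_H,E_H)$ together with an injective map $\iota:T\to V_H$. A unit flow from $o$ to infinity is an antisymmetric function $\theta$ on oriented edges with $\operatorname{div}\theta(o)=1$ and $\operatorname{div}\theta(x)=0$ for $x\ne o$, where $\operatorname{div}\theta(x)$ is the sum of $\theta$ over all oriented edges leaving $x$ (parallel edges counted separately). A gauge is an increasing convex function $\Phi:[0,\infty)\to[0,\infty)$ with $\Phi(0)=0$ (increasing is understood strictly, so that $\Phi(t)>0$ for $t>0$). For integers $m\ge1$ put $\alpha_\Phi(m)=\sup_{t>0}\Phi(mt)/\Phi(t)$ and $\beta_\Phi(m)=\alpha_\Phi(m)/m$. ''$\mathcal{B}^{\sharp}=(T,F)$ is repaired in $H$ by paths $\{\gamma_e\}$'' means: for each $e=\{u,v\}\in F$, $\gamma_e$ is a finite path in $H$ joining $\iota(u)$ to $\iota(v)$. Sums over $a\in E_H$ and $e\in F$ are over unoriented edges. Lifted flow: orient each $e\in F$, orient $\gamma_e$ consistently (from $\iota(u)$ to $\iota(v)$ if $e$ is oriented from $u$ to $v$), and let $\eta_e$ be the unit path flow along $\gamma_e$ (value $1$ on edges traversed in the direction of $\gamma_e$, $-1$ on the reversed edges, $0$ elsewhere). The lift of $\theta$ is $\Theta=\sum_{e\in F}\theta(e)\eta_e$.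 *)

(* Defs.v *)
From mathcomp Require Import all_boot all_order all_algebra finmap.
From mathcomp Require Import all_classical all_reals all_analysis.

Set Implicit Arguments.
Unset Strict Implicit.
Unset Printing Implicit Defensive.

Import Order.TTheory GRing.Theory Num.Theory.

Local Open Scope classical_set_scope.
Local Open Scope ring_scope.

(* An undirected multigraph. The order in which [src] and [tgt] list the two
   ends of an edge is an arbitrary reference orientation, needed only to name
   the two oriented versions of that edge. *)
Record multigraph := Multigraph {
  vertex : choiceType;
  edge : choiceType;
  src : edge -> vertex;
  tgt : edge -> vertex
}.

Section Multigraph.
Variable G : multigraph.

(* [(e, true)] is [e] oriented from [src e] to [tgt e], [(e, false)] is its
   reversal. *)
Definition oedge : choiceType := (edge G * bool)%type.

Definition orev (a : oedge) : oedge := (a.1, ~~ a.2).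
Definition otail (a : oedge) : vertex G := if a.2 then src a.1 else tgt a.1.
Definition ohead (a : oedge) : vertex G := otail (orev a).

Definition out_edges (x : vertex G) : set oedge := [set a | otail a = x].

Definition locally_finite := forall x, finite_set (out_edges x).

Fixpoint is_walk (x : vertex G) (p : seq oedge) (y : vertex G) : bool :=
  if p is a :: p' then (otail a == x) && is_walk (ohead a) p' y else x == y.

Definition is_path (x : vertex G) (p : seq oedge) (y : vertex G) : bool :=
  is_walk x p y && uniq (x :: map ohead p).

Definition connected_graph := forall x y, exists p, is_walk x p y.

Definition path_edges (p : seq oedge) : set (edge G) :=
  [set e | e \in map fst p].

Section Flow.
Variable R : realType.

Definition divergence (theta : oedge -> R) (x : vertex G) : R :=
  \sum_(a \in out_edges x) theta a.

Definition antisymmetric_flow (theta : oedge -> R) :=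
  forall a, theta (orev a) = - theta a.

Definition unit_flow (o : vertex G) (theta : oedge -> R) :=
  [/\ antisymmetric_flow theta,
      divergence theta o = 1 &
      forall x, x <> o -> divergence theta x = 0].

Definition path_flow (p : seq oedge) (a : oedge) : R :=
  if a \in p then 1 else if orev a \in p then -1 else 0.

End Flow.
End Multigraph.

Definition subnetwork (B : multigraph) (F : set (edge B)) : multigraph :=
  @Multigraph (vertex B) F (fun e => src (val e)) (fun e => tgt (val e)).

(* The root is a vertex of [B] on which no condition is imposed. *)
Definition demand_network (B : multigraph) :=
  [/\ infinite_set [set: vertex B], locally_finite B & connected_graph B].

Definition physical_network (B H : multigraph) (iota : vertex B -> vertex H) :=
  [/\ infinite_set [set: vertex H], locally_finite H & injective iota].

Section Repair.
Variables (S H : multigraph) (iota : vertex S -> vertex H).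
Variable gamma : edge S -> seq (oedge H).

Definition repaired := forall e, is_path (iota (src e)) (gamma e) (iota (tgt e)).

Definition users (a : edge H) : set (edge S) :=
  [set e | path_edges (gamma e) a].

(* Meaningful when [users a] is finite. *)
Definition congestion (a : edge H) : nat := #|` fset_set (users a)|.

(* Each demand edge is given its reference orientation, from [src e] to
   [tgt e], which is also the direction in which [gamma e] runs; by antisymmetry
   of [theta] the lift does not depend on this choice. The sum is finite when
   [users a.1] is. *)
Definition lift_flow (R : realType) (theta : oedge S -> R) (a : oedge H) : R :=
  \sum_(e \in [set: edge S]) theta (e, true) * path_flow R (gamma e) a.

End Repair.

Section Gauge.
Variables (R : realType) (Phi : R -> R).

(* Only the values of [Phi] on [0, +oo[ matter. *)
Definition gauge :=
  [/\ forall t, 0 <= t -> 0 <= Phi t,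
      {in `[0, +oo[ &, {homo Phi : s t / s < t}},
      @convex_function R R^o `[0, +oo[%classic Phi &
      Phi 0 = 0].

Definition alpha (m : nat) : \bar R :=
  ereal_sup [set (Phi (m%:R * t) / Phi t)%:E | t in [set t | 0 < t]].

Definition beta (m : nat) : \bar R := (alpha m * (m%:R^-1)%:E)%E.

End Gauge.

Definition edge_cost (R : realType) (S H : multigraph)
    (gamma : edge S -> seq (oedge H)) (Phi : R -> R) (w : edge H -> R)
    (e : edge S) : \bar R :=
  (\sum_(a \in path_edges (gamma e)) (w a)%:E * beta Phi (congestion gamma a))%E.

(* Main.v *)
Require Import Defs.
From mathcomp Require Import all_boot all_order all_algebra finmap.
From mathcomp Require Import all_classical all_reals all_analysis.
From mathcomp Require Import ring.

(** The estimate is local: it is a convexity inequality on each physical edge,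
    followed by an exchange of sums.

    Fix a physical edge [a] used by [m] of the paths. The lift at [a] is a signed
    sum of the demands routed through [a], so its absolute value is at most the
    sum of their [m] absolute values ([abs_lift_flow_le]). Write that sum as [m]
    times the mean. By definition of [alpha], [Phi] of it is at most [alpha Phi m]
    times [Phi] of the mean, and by Jensen's inequality ([jensen_mean]) [Phi] of
    the mean is at most the mean of the values of [Phi]. Hence each user of [a]
    is charged [beta Phi m = alpha Phi m / m] times its own energy
    ([gauge_sum_le], [gauge_lift_flow_le]).

    Multiplying by the weight of [a] and summing over [a] gives a nonnegative
    double sum over the pairs of a physical edge and a path through it. Summed
    in the other order ([exchange_esum]), it collects for each demand edge [e]
    the finite sum over its path of weight times [beta], which is exactly the
    cost of [e] ([weighted_repair]). The unweighted case is weight 1, and the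
    quadratic case follows from [alpha = m ^ 2], hence [beta = m], for
    the gauge [t ^ 2] ([square_gauge], [beta_square]). *)

Set Implicit Arguments.
Unset Strict Implicit.
Unset Printing Implicit Defensive.

Import Order.TTheory GRing.Theory Num.Theory.

Local Open Scope classical_set_scope.
Local Open Scope ring_scope.

(** * Gauges and congestion factors *)

Lemma gauge_le (R : realType) (Phi : R -> R) (s t : R) :
  gauge Phi -> 0 <= s -> s <= t -> Phi s <= Phi t.
Proof.
move=> [_ Phi_incr _ _] s0; rewrite le_eqVlt => /orP[/eqP->//|lt_st].
apply/ltW/Phi_incr => //; rewrite in_itv/= ?andbT//.
exact: le_trans s0 (ltW lt_st).
Qed.

(** Jensen's inequality for the uniform mean, by induction: the mean of [n.+1]
    numbers is the convex combination, with weight 1/(n+1) on the first one,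
    of that number and the mean of the others. The empty mean is 0 and
    [Phi 0 = 0], so the empty sequence is no exception. *)
Lemma jensen_mean (R : realType) (I : Type) (s : seq I) (Phi : R -> R)
    (x : I -> R) :
  gauge Phi -> (forall i, 0 <= x i) ->
  Phi ((size s)%:R^-1 * \sum_(i <- s) x i) <=
    (size s)%:R^-1 * \sum_(i <- s) Phi (x i).
Proof.
move=> [Phi_ge0 _ Phi_convex Phi0] x0.
elim: s => [|i s IHs]; first by rewrite !big_nil !mulr0 Phi0.
rewrite !big_cons /=; set n := size s.
have p01 : 0 <= (n.+1%:R^-1 : R) <= 1.
  by rewrite invr_ge0 ltW//= invf_le1// ler1n.
pose p := Itv01 (andP p01).1 (andP p01).2.
pose avg := n%:R^-1 * \sum_(j <- s) x j.
have avg_ge0 : 0 <= avg by rewrite mulr_ge0 ?invr_ge0// sumr_ge0.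
(* Both sides vanish when the tail is empty, where the weight 1 - 1/(n+1) is 0. *)
have restE (f : I -> R) : n.+1%:R^-1 * \sum_(j <- s) f j =
    (1 - n.+1%:R^-1) * (n%:R^-1 * \sum_(j <- s) f j).
  have [n0|n_neq0] := eqVneq n 0%N; first by rewrite (size0nil n0) big_nil !mulr0.
  have nR : (n%:R : R) != 0 by rewrite pnatr_eq0.
  by rewrite -natr1; field; rewrite nR natr1 pnatr_eq0.
have := Phi_convex p (x i) avg; rewrite !inE/= !in_itv/= !andbT => /(_ (x0 i) avg_ge0).
rewrite !convRE /= => cvx.
rewrite !mulrDr !restE; apply: le_trans cvx _.
by rewrite lerD2l ler_wpM2l// subr_ge0 (andP p01).2.
Qed.

Local Open Scope ereal_scope.

Lemma alpha_ge0 (R : realType) (Phi : R -> R) (m : nat) :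
  gauge Phi -> 0 <= alpha Phi m.
Proof.
move=> [Phi_ge0 _ _ _]; apply: le_trans (ereal_sup_ubound _); last first.
  by exists 1%R => //=.
by rewrite lee_fin divr_ge0 ?Phi_ge0// mulr_ge0.
Qed.

Lemma beta_ge0 (R : realType) (Phi : R -> R) (m : nat) :
  gauge Phi -> 0 <= beta Phi m.
Proof. by move=> gPhi; rewrite mule_ge0 ?alpha_ge0// lee_fin invr_ge0. Qed.

(** [alpha Phi m] is a supremum over [t > 0] only; at [t = 0] the bound holds
    because [Phi 0 = 0] and [alpha * 0 = 0] even when [alpha] is infinite. *)
Lemma gauge_alpha (R : realType) (Phi : R -> R) (m : nat) (t : R) :
  gauge Phi -> (0 <= t)%R -> (Phi (m%:R * t)%R)%:E <= alpha Phi m * (Phi t)%:E.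
Proof.
move=> [_ Phi_incr _ Phi0]; rewrite le_eqVlt => /orP[/eqP<-|t_gt0].
  by rewrite mulr0 Phi0 mule0.
have Phit : (0 < Phi t)%R.
  by rewrite -Phi0; apply: Phi_incr => //; rewrite in_itv/= ?lexx ?ltW.
rewrite -lee_pdivrMr// -EFinM; apply: ereal_sup_ubound.
by exists t.
Qed.

(** The inequality behind the whole estimate. A sum of [m] terms is [m] times
    their mean: [alpha Phi m] pays for pulling the factor [m] out of [Phi], and
    Jensen's inequality at the mean gives back the factor [1/m], which together
    make [beta Phi m]. *)
Lemma gauge_sum_le (R : realType) (I : Type) (s : seq I) (Phi : R -> R)
    (x : I -> R) :
  gauge Phi -> (forall i, (0 <= x i)%R) ->
  (Phi (\sum_(i <- s) x i)%R)%:E <=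
    beta Phi (size s) * (\sum_(i <- s) Phi (x i))%R%:E.
Proof.
move=> gPhi x0; have [Phi_ge0 _ _ Phi0] := gPhi.
have [s0|s_neq0] := eqVneq (size s) 0%N.
  by rewrite (size0nil s0) !big_nil Phi0 mule0.
have sR : ((size s)%:R : R) != 0%R by rewrite pnatr_eq0.
have avg_ge0 : (0 <= (size s)%:R^-1 * \sum_(i <- s) x i)%R.
  by rewrite mulr_ge0 ?invr_ge0// sumr_ge0.
have := gauge_alpha (size s) gPhi avg_ge0; rewrite mulVKf// => /le_trans; apply.
rewrite /beta -muleA -EFinM; apply: lee_wpmul2l; first exact: alpha_ge0.
by rewrite lee_fin jensen_mean.
Qed.

(** * The lifted flow on one physical edge *)

Lemma abs_path_flow_le1 (R : realType) (G : multigraph) (p : seq (oedge G))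
    (a : oedge G) : (`|path_flow R p a| <= 1)%R.
Proof.
by rewrite /path_flow; do 2?case: ifP => _; rewrite ?normrN ?normr1 ?normr0.
Qed.

Lemma path_flow_off (R : realType) (G : multigraph) (p : seq (oedge G))
    (a : oedge G) : ~ path_edges p a.1 -> path_flow R p a = 0%R.
Proof.
move=> ap; have off b : b.1 = a.1 -> (b \in p) = false.
  by move=> ba; apply/negP => bp; apply: ap; rewrite -ba; exact: map_f.
by rewrite /path_flow !off.
Qed.

(** Only the demand edges routed through [a] contribute to the lift at [a], each
    with a coefficient in {-1, 0, 1}. Opposite contributions may cancel, and
    the bound discards that cancellation. *)
Lemma abs_lift_flow_le (R : realType) (S H : multigraph)
    (gamma : edge S -> seq (oedge H)) (theta : oedge S -> R) (a : oedge H) :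
  finite_set (users gamma a.1) ->
  (`|lift_flow gamma theta a| <=
     \sum_(e <- fset_set (users gamma a.1)) `|theta (e, true)|)%R.
Proof.
move=> fin_users.
rewrite /lift_flow -(@fsbig_widen _ _ _ _ (users gamma a.1))//; last first.
  by move=> e [_ eNa] /=; rewrite path_flow_off ?mulr0.
rewrite fsbig_finite//; apply: le_trans (ler_norm_sum _ _ _) _.
by apply: ler_sum => e _; rewrite normrM ler_piMr// abs_path_flow_le1.
Qed.

Lemma gauge_lift_flow_le (R : realType) (S H : multigraph)
    (gamma : edge S -> seq (oedge H)) (Phi : R -> R) (theta : oedge S -> R)
    (a : edge H) :
  gauge Phi -> finite_set (users gamma a) ->
  (Phi `|lift_flow gamma theta (a, true)|%R)%:E <=
    \esum_(e in users gamma a)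
      (beta Phi (congestion gamma a) * (Phi `|theta (e, true)|%R)%:E).
Proof.
move=> gPhi fin_users; have [Phi_ge0 _ _ _] := gPhi.
rewrite esum_fset//; last first.
  by move=> e _; rewrite mule_ge0 ?beta_ge0// lee_fin Phi_ge0.
rewrite fsbig_finite//= -ge0_sume_distrr; last first.
  by move=> e _; rewrite lee_fin Phi_ge0.
rewrite sumEFin; apply: le_trans (gauge_sum_le _ gPhi _); last by move=> e.
by rewrite lee_fin; apply: gauge_le => //; exact: (@abs_lift_flow_le _ _ _ _ _ (a, true)).
Qed.

(** * Charging physical edges back to demand edges *)

(** Tonelli for a double sum over the pairs related by [P]: both sides are the
    sum over the graph of [P], once enumerated by rows and once by columns.
    With [P] the relation between a physical edge and a path through it, this
    turns a sum over users of edges into a sum over edges of paths. *)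
Lemma exchange_esum (R : realType) (I J : choiceType) (P : I -> J -> Prop)
    (f : I -> J -> \bar R) :
  (forall i j, 0 <= f i j) ->
  \esum_(i in [set: I]) \esum_(j in [set j | P i j]) f i j =
  \esum_(j in [set: J]) \esum_(i in [set i | P i j]) f i j.
Proof.
move=> f0; rewrite !esum_esum//.
rewrite (@reindex_esum _ _ _ ([set: J] `*`` fun j => [set i | P i j]) _
  (fun k => (k.2, k.1))) //.
split=> [[j i] [_ /= Pij]|[j i] [j' i'] _ _ [-> ->]|[i j] [_ /= Pij]] //.
by exists (j, i).
Qed.

Lemma finite_path_edges (G : multigraph) (p : seq (oedge G)) :
  finite_set (path_edges p).
Proof. exact: finite_seq. Qed.

(** Each physical edge is bounded by its users, and the exchange of sums charges
    that bound to the demand edges; each of these collects its cost along its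
    path. *)
Lemma weighted_repair (R : realType) (S H : multigraph)
    (gamma : edge S -> seq (oedge H)) (Phi : R -> R) (w : edge H -> R)
    (theta : oedge S -> R) :
  gauge Phi -> (forall a, (0 <= w a)%R) ->
  (forall a, finite_set (users gamma a)) ->
  \esum_(a in [set: edge H])
     ((w a)%:E * (Phi `|lift_flow gamma theta (a, true)|%R)%:E) <=
  \esum_(e in [set: edge S])
     (edge_cost gamma Phi w e * (Phi `|theta (e, true)|%R)%:E).
Proof.
move=> gPhi w0 fin_users; have [Phi_ge0 _ _ _] := gPhi.
pose c a := (w a)%:E * beta Phi (congestion gamma a).
have c_ge0 a : 0 <= c a by rewrite mule_ge0 ?beta_ge0// lee_fin.
have Phi_norm_ge0 (t : R) : 0 <= (Phi `|t|%R)%:E by rewrite lee_fin Phi_ge0.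
pose f a e := c a * (Phi `|theta (e, true)|%R)%:E.
have f_ge0 a e : 0 <= f a e by rewrite mule_ge0.
apply: (@le_trans _ _ (\esum_(a in [set: edge H]) \esum_(e in users gamma a) f a e)).
  apply: le_esum => a _.
  have wa : 0 <= (w a)%:E by rewrite lee_fin.
  apply: le_trans (lee_wpmul2l wa (gauge_lift_flow_le theta gPhi (fin_users a))) _.
  rewrite !esum_fset//; last by move=> e _; rewrite mule_ge0 ?beta_ge0.
  rewrite ge0_mule_fsumr//; last by move=> e; rewrite mule_ge0 ?beta_ge0.
  by apply: lee_fsum => // e _; rewrite /f muleA.
rewrite (@exchange_esum R _ _ (fun a e => path_edges (gamma e) a))//.
apply: le_esum => e _.
have fin_e := finite_path_edges (gamma e).
by rewrite (esum_fset fin_e)// /edge_cost -ge0_mule_fsuml.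
Qed.

(** * The quadratic gauge *)

Lemma square_gauge (R : realType) : gauge (fun t : R => t ^+ 2)%R.
Proof.
split=> [t _|s t|p x y _ _|].
- exact: sqr_ge0.
- by rewrite !in_itv/= !andbT => s0 t0 lt_st; rewrite ltr_pXn2r.
- rewrite !convRE /= -subr_ge0.
  have [p0 p1] : (0 <= p%:num)%R /\ (p%:num <= 1)%R by [].
  set q := (p%:num)%R in p0 p1 *.
  have -> : (q * x ^+ 2 + (1 - q) * y ^+ 2 - (q * x + (1 - q) * y) ^+ 2 =
    q * (1 - q) * (x - y) ^+ 2)%R by ring.
  by apply: mulr_ge0 (sqr_ge0 _); apply: mulr_ge0 => //; rewrite subr_ge0.
- by rewrite expr0n.
Qed.

(** [(m t)^2 / t^2] is constant in [t], so the supremum is over a single value. *)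
Lemma alpha_square (R : realType) (m : nat) :
  alpha (fun t : R => t ^+ 2)%R m = (m%:R ^+ 2)%:E.
Proof.
have ratioE (t : R) : (0 < t)%R -> ((m%:R * t) ^+ 2 / t ^+ 2 = m%:R ^+ 2)%R.
  by move=> t0; rewrite exprMn mulfK// expf_neq0// gt_eqF.
rewrite /alpha (_ : [set _ | _ in _] = [set (m%:R ^+ 2)%:E]) ?ereal_sup1//.
apply/seteqP; split=> [_ [t /= t0 <-]|_ ->]; first by rewrite /= ratioE.
by exists 1%R; rewrite /= ?ratioE.
Qed.

Lemma beta_square (R : realType) (m : nat) :
  beta (fun t : R => t ^+ 2)%R m = m%:R%:E.
Proof.
rewrite /beta alpha_square -EFinM; have [->|m0] := eqVneq m 0%N.
  by rewrite invr0 mulr0.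
by rewrite expr2 mulfK// pnatr_eq0.
Qed.

Theorem theorem3p6 (R : realType) (B : multigraph) (o : vertex B)
    (H : multigraph) (iota : vertex B -> vertex H)
    (F : set (edge B)) (gamma : edge (subnetwork F) -> seq (oedge H)) :
  demand_network B ->
  physical_network iota ->
  @repaired (subnetwork F) H iota gamma ->
  (forall a : edge H, finite_set (users gamma a)) ->
  [/\ forall (Phi : R -> R) (w : edge H -> R)
             (theta : oedge (subnetwork F) -> R),
        gauge Phi ->
        (forall a, (0 < w a)%R) ->
        (forall a, (1 <= congestion gamma a)%N ->
           alpha Phi (congestion gamma a) < +oo) ->
        @unit_flow (subnetwork F) R o theta ->
        \esum_(e in [set: edge (subnetwork F)])
           (edge_cost gamma Phi w e * (Phi `|theta (e, true)|%R)%:E) < +oo ->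
        \esum_(a in [set: edge H])
           ((w a)%:E * (Phi `|lift_flow gamma theta (a, true)|%R)%:E) <=
        \esum_(e in [set: edge (subnetwork F)])
           (edge_cost gamma Phi w e * (Phi `|theta (e, true)|%R)%:E),
      forall (Phi : R -> R) (theta : oedge (subnetwork F) -> R),
        gauge Phi ->
        (forall a, (1 <= congestion gamma a)%N ->
           alpha Phi (congestion gamma a) < +oo) ->
        @unit_flow (subnetwork F) R o theta ->
        \esum_(e in [set: edge (subnetwork F)])
           ((\sum_(a \in path_edges (gamma e)) beta Phi (congestion gamma a)) *
            (Phi `|theta (e, true)|%R)%:E) < +oo ->
        \esum_(a in [set: edge H])
           (Phi `|lift_flow gamma theta (a, true)|%R)%:E <=
        \esum_(e in [set: edge (subnetwork F)])
           ((\sum_(a \in path_edges (gamma e)) beta Phi (congestion gamma a)) *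
            (Phi `|theta (e, true)|%R)%:E)
    & forall (r : edge H -> R) (theta : oedge (subnetwork F) -> R),
        (forall a, (0 < r a)%R) ->
        @unit_flow (subnetwork F) R o theta ->
        \esum_(e in [set: edge (subnetwork F)])
           ((\sum_(a \in path_edges (gamma e))
               r a * (congestion gamma a)%:R) * theta (e, true) ^+ 2)%:E
          < +oo ->
        \esum_(a in [set: edge H])
           (r a * lift_flow gamma theta (a, true) ^+ 2)%:E <=
        \esum_(e in [set: edge (subnetwork F)])
           ((\sum_(a \in path_edges (gamma e))
               r a * (congestion gamma a)%:R) * theta (e, true) ^+ 2)%:E ].
Proof.
move=> _ _ _ fin_users; split=> [Phi w theta gPhi w0 _ _ _|Phi theta gPhi _ _ _
  |r theta r0 _ _].
- by apply: weighted_repair => // a; exact: ltW.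
- have := weighted_repair theta gPhi (fun=> ler01) fin_users.
  congr (_ <= _); apply: eq_esum => a _; first by rewrite mul1e.
  by rewrite /edge_cost; under eq_fsbigr do rewrite mul1e.
- have := weighted_repair theta (square_gauge R) (fun a => ltW (r0 a)) fin_users.
  congr (_ <= _); apply: eq_esum => a _.
    by rewrite -EFinM real_normK ?num_real.
  rewrite /edge_cost real_normK ?num_real// [RHS]EFinM -fsumEFin//; last first.
    exact: finite_path_edges.
  by congr (_ * _); apply: eq_fsbigr => b _; rewrite beta_square.
Qed.
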